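(* Let $r, k, d$ and $\ell$ be integers satisfying $k>2r^2\left(1-\frac{1}{\ell^2}\right)$. Suppose $c_1,\dots,c_k\in\mathbb{F}_q[t]$ have degree at most $d$ and satisfy $\sum_{i=1}^k c_i=0$. Let $F(x)\in\mathbb{F}_q[t][x]$ be a polynomial of degree $\ell$ with constant term zero. Then there exist constants $c=c(q,r,k,\ell)\in(0,1)$ and $c'=c'(q,r,k,d,F)>0$ such that the following holds: any $A\subset G_n$ satisfying $|A|>c'\cdot q^{cn}$ must contain a nontrivial solution to $$c_1a_1^r+\cdots+c_ka_k^r=F(b)$$ for some $b\in\mathbb{F}_q[t]$.
   Context: $\mathbb{F}_q$ denotes the finite field with $q$ elements, where $q$ is a power of a prime, and $\mathbb{F}_q[t]$ is the ring of polynomials over $\mathbb{F}_q$ in an indeterminate $t$. $G_n\subset\mathbb{F}_q[t]$ is the set of all polynomials in $\mathbb{F}_q[t]$ with degree less than $n$. The degree $\ell$ and the constant term of $F$ are taken with respect to the variable $x$. The notation $c(q,r,k,\ell)$ and $c'(q,r,k,d,F)$ indicates that the constants depend only on the listed quantities. A solution in $A$ means $a_1,\dots,a_k\in A$ together with $b\in\mathbb{F}_q[t]$ satisfying the equation; a trivial solution means $(a_1,\dots,a_k)=(a,\dots,a)$ for some $a\in A$ and $b=0$, and a solution is nontrivial if it is not trivial.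
   Formalization: The formal theorem assumes k ≥ 2; for k = 1, ℓ = 1 the claim fails: c_1 = 0 and F(x) = x give the equation 0 = b, whose solutions are all trivial. *)

(* Defs.v *)
From HB Require Import structures.
From mathcomp Require Import all_boot all_order all_algebra.
From mathcomp Require Import reals exp.

Set Implicit Arguments.
Unset Strict Implicit.
Unset Printing Implicit Defensive.

Import Order.TTheory GRing.Theory Num.Theory.

Local Open Scope ring_scope.

(* {poly_n Fq} is G_n: the finite type of polynomials p with
   size p <= n, that is, of degree < n. *)

Section Solutions.

Variables (Fq : finFieldType) (r k n : nat).

Definition is_solution (c : 'I_k -> {poly Fq}) (F : {poly {poly Fq}})
    (A : {set {poly_n Fq}}) (a : 'I_k -> {poly_n Fq}) (b : {poly Fq}) : Prop :=
  (forall i, a i \in A) /\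
  \sum_(i < k) c i * (a i : {poly Fq}) ^+ r = F.[b].

Definition is_trivial (A : {set {poly_n Fq}})
    (a : 'I_k -> {poly_n Fq}) (b : {poly Fq}) : Prop :=
  (exists2 x, x \in A & forall i, a i = x) /\ b = 0.

End Solutions.

(* Main.v *)
Require Import Defs.
From HB Require Import structures.
From mathcomp Require Import all_boot all_order all_algebra all_field.
From mathcomp Require Import reals exp.
From mathcomp Require Import boolp.
From mathcomp Require Import zify ring lra.

(** The proof is the Croot-Lev-Pach polynomial method, in its slice-rank form,
    applied to a tensor that counts values of b.

    Put m = floor(r n / l) and let b range over the polynomials of degree less
    than m, so that both sides of the equation have degree at most r n + O(1).
    The equation c_1 a_1^r + ... + c_k a_k^r = F(b) then says that N = r n + O(1)
    coefficients vanish; each of them is a polynomial in the coefficients of the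
    a_i and of b.  By Fermat,
      T(a_1, ..., a_k) = sum_b prod_(j < N) (1 - (j-th coefficient)^(q-1))
    is the number of admissible b, read in F_q.  If A has no nontrivial solution,
    then for a_1, ..., a_k in A it is 1 when all the a_i coincide (only b = 0
    counts) and 0 otherwise: T is the identity tensor on A, and a slice-rank
    decomposition of T must have at least |A| terms ([diagonal_slice_rank]).

    On the other hand T has few slices.  Give the coefficients of the a_i weight
    l and those of b weight r: every coefficient of the equation has weighted
    degree at most r l, hence the summand has weighted degree at most
    N (q-1) r l.  Summing b over all of F_q^m kills every monomial in which some
    coefficient of b has exponent below q-1, because sum_(a in F_q) a^e = 0 for
    e < q-1 ([sum_expr_eq0]).  The surviving monomials spend weight r m (q-1) on
    b, so their total degree in the a_i is at most
      (q-1) r (N - m / l) = (q-1) r^2 (1 - 1/l^2) n + O(1).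
    One of the k blocks of variables carries at most the average degree
    ([fibre_sum_slices]), and the hypothesis on k makes that average smaller than
    (1/2 - delta) (q-1) n.  The number of reduced monomials in n variables of
    such a degree is at most C q^(c n) with c < 1: this is the exponential
    moment bound [low_degree_count], whose base is less than q because the mean
    exponent of a random reduced monomial is (q-1)/2 ([saddle_point]). *)

Set Implicit Arguments.
Unset Strict Implicit.
Unset Printing Implicit Defensive.

Import Order.TTheory GRing.Theory Num.Theory.

Local Open Scope ring_scope.

(** * Slice rank of diagonal tensors *)

(** Choose \rank B linearly independent columns of B: on them a combination
    of the rows can be prescribed, and in particular be 1 everywhere. *)
Lemma row_space_large_support (K : fieldType) (m n : nat) (B : 'M[K]_(m, n)) :
  exists u : 'rV[K]_m, (\rank B <= #|[set j | (u *m B) 0%R j != 0%R]|)%N.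
Proof.
pose f := maxrankfun B^T.
pose C := rowsub f B^T.
have rC : \rank C = \rank B^T by rewrite eq_maxrowsub.
have freeC : row_free C by rewrite /row_free rC.
have fullCT : row_full C^T by rewrite /row_full mxrank_tr rC.
have /submxP[u uP] : ((const_mx 1 : 'rV[K]_(\rank B^T)) <= C^T)%MS by rewrite submx_full.
exists u.
rewrite -(mxrank_tr B) -{1}(card_ord (\rank B^T)) -(card_imset _ (@maxrankfun_inj _ _ _ B^T)).
apply: subset_leq_card; apply/subsetP => _ /imsetP[j _ ->]; rewrite inE.
have /rowP/(_ j) := uP; rewrite !mxE => uBj.
suff -> : \sum_j0 u 0 j0 * B j0 (f j) = 1 by rewrite oner_eq0.
by rewrite uBj; apply: eq_bigr => i _; rewrite !mxE.
Qed.

(** This supplies the test function that eliminates one coordinate from a slice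
    decomposition: it annihilates the slices along that coordinate while keeping
    most of the diagonal. *)
Lemma orthogonal_large_support (K : fieldType) (X T : finType) (A : {set X})
    (S : {set T}) (f : T -> X -> K) :
  exists2 h : X -> K, (forall s, s \in S -> \sum_(a in A) h a * f s a = 0) &
    (#|A| <= #|[set a in A | h a != 0%R]| + #|S|)%N.
Proof.
pose M : 'M[K]_(#|A|, #|S|) := \matrix_(i, j) f (enum_val j) (enum_val i).
have [u uP] := row_space_large_support (kermx M).
have uM : u *m kermx M *m M = 0 by rewrite -mulmxA mulmx_ker mulmx0.
set v := u *m kermx M in uP uM.
pose h a := if insub (index a (enum A)) is Some i then v 0 i else 0.
have hE (i : 'I_#|A|) : h (enum_val i) = v 0 i.
  have ltA : (index (enum_val i) (enum A) < #|A|)%N.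
    by rewrite cardE index_mem mem_enum enum_valP.
  rewrite /h insubT; congr (v 0 _); apply: val_inj => /=.
  by rewrite (enum_val_nth (enum_val i)) index_uniq ?enum_uniq // -cardE.
exists h.
  move=> s sS; rewrite big_enum_val /=.
  transitivity ((v *m M) 0 (enum_rank_in sS s)); last by rewrite uM mxE.
  rewrite mxE; apply: eq_bigr => i _.
  by rewrite hE; congr (_ * _); rewrite mxE enum_rankK_in.
move: uP; rewrite mxrank_ker leq_subLR addnC => /leq_trans; apply.
apply: leq_add (rank_leq_col M).
rewrite -(card_imset _ enum_val_inj); apply: subset_leq_card.
apply/subsetP => _ /imsetP[j + ->]; rewrite !inE hE => ->.
by rewrite enum_valP.
Qed.

Definition update (I : finType) (X : Type) (x : {ffun I -> X}) (i : I) (a : X) :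
  {ffun I -> X} := [ffun j => if j == i then a else x j].

Lemma updateC (I : finType) (X : Type) (x : {ffun I -> X}) i j a b : i != j ->
  update (update x i a) j b = update (update x j b) i a.
Proof.
move=> ij; apply/ffunP => l; rewrite !ffunE.
by case: (eqVneq l j) => // ->; rewrite eq_sym (negPf ij).
Qed.

Section SliceRank.
Variables (K : fieldType) (I X T : finType).
Implicit Types (J : {set I}) (A : {set X}) (S : {set T}).

(** Coordinates outside [J] are spectators: they let every tensor obtained by
    eliminating coordinates live on the same space of arguments. *)
Definition slice_expansion J A S (t : {ffun I -> X} -> K)
    (f : I -> T -> X -> K) (g : I -> T -> {ffun I -> X} -> K) :=
  (forall i s x a, g i s (update x i a) = g i s x) /\
  forall x : {ffun I -> X}, (forall i, i \in J -> x i \in A) ->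
    t x = \sum_(i in J) \sum_(s in S) f i s (x i) * g i s x.

Definition diagonal J i0 (d : X -> K) (x : {ffun I -> X}) :=
  if [forall i in J, x i == x i0] then d (x i0) else 0.

(** With two coordinates a slice is a matrix of rank one, and an invertible
    diagonal matrix indexed by [A] has rank |A|. *)
Lemma slice_rank_pair i0 i1 A S d f g : i0 != i1 ->
  {in A, forall a, d a != 0} ->
  slice_expansion [set i0; i1] A S (diagonal [set i0; i1] i0 d) f g ->
  (#|A| <= 2 * #|S|)%N.
Proof.
move=> i01 dN0 [gi tE].
have [->|[a0 a0A]] := set_0Vmem A; first by rewrite cards0.
pose x0 : {ffun I -> X} := [ffun=> a0].
pose D : 'M[K]_#|A| := diag_mx (\row_j d (enum_val j)).
pose F : 'M[K]_(#|A|, #|S|) := \matrix_(a, s) f i0 (enum_val s) (enum_val a).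
pose G : 'M[K]_(#|S|, #|A|) := \matrix_(s, b) g i0 (enum_val s) (update x0 i1 (enum_val b)).
pose F' : 'M[K]_(#|A|, #|S|) := \matrix_(a, s) g i1 (enum_val s) (update x0 i0 (enum_val a)).
pose G' : 'M[K]_(#|S|, #|A|) := \matrix_(s, b) f i1 (enum_val s) (enum_val b).
have DE : D = F *m G + F' *m G'.
  apply/matrixP => a b; rewrite !mxE.
  pose x := update (update x0 i0 (enum_val a)) i1 (enum_val b).
  have x_i0 : x i0 = enum_val a by rewrite !ffunE eqxx (negPf i01).
  have x_i1 : x i1 = enum_val b by rewrite !ffunE eqxx.
  have xA i : i \in [set i0; i1] -> x i \in A.
    by rewrite !inE => /orP[]/eqP->; rewrite ?x_i0 ?x_i1 enum_valP.
  have := tE x xA; rewrite big_setU1 ?inE //= big_set1 x_i0 x_i1.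
  have -> : diagonal [set i0; i1] i0 d x = d (enum_val a) *+ (a == b).
    rewrite /diagonal; case: (eqVneq a b) => [ab|ab].
      rewrite ifT ?x_i0 ?ab //.
      by apply/'forall_implyP => i; rewrite !inE => /orP[]/eqP->; rewrite ?x_i0 ?x_i1 ?ab.
    rewrite ifF //; apply/negbTE; apply: contra ab => /'forall_implyP/(_ i1).
    by rewrite !inE eqxx orbT x_i0 x_i1 => /(_ isT) /eqP/enum_val_inj->.
  move=> ->; rewrite [X in X + _]big_enum_val [X in _ + X]big_enum_val /=.
  congr (_ + _); apply: eq_bigr => s _; rewrite !mxE.
    by rewrite /x updateC // gi.
  by rewrite /x gi mulrC.
have rD : \rank D = #|A|.
  apply: mxrank_unit; rewrite unitmxE det_diag unitfE.
  by apply/prodf_neq0 => j _; rewrite mxE dN0 ?enum_valP.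
rewrite -rD DE mul2n -addnn.
apply: leq_trans (mxrank_add _ _) (leq_add _ _).
  exact: leq_trans (mxrankM_maxl _ _) (rank_leq_col _).
exact: leq_trans (mxrankM_maxl _ _) (rank_leq_col _).
Qed.

(** Tao's bound for the slice rank of a diagonal tensor.  A third coordinate i2
    is eliminated by summing against an h orthogonal to the slices along i2: the
    tensor stays diagonal, now with entries d h on the support of h, and that
    support misses at most |S| elements of [A].  The induction stops at two
    coordinates, since with a single one any function is one slice. *)
Lemma diagonal_slice_rank i0 i1 J A S d f g : i0 != i1 ->
  i0 \in J -> i1 \in J -> {in A, forall a, d a != 0} ->
  slice_expansion J A S (diagonal J i0 d) f g -> (#|A| <= #|J| * #|S|)%N.
Proof.
move=> i01; move cJ: #|J| => N; elim: N J cJ A d g => [|n IHn] J cJ A d g i0J i1J dN0 [gi tE].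
  by move/eqP: cJ; rewrite cards_eq0 => /eqP J0; rewrite J0 inE in i0J.
have [J01|] := boolP (J == [set i0; i1]).
  have -> : n.+1 = 2 by rewrite -cJ (eqP J01) cards2 i01.
  by apply: (slice_rank_pair (d := d) (f := f) (g := g) i01) => //; rewrite -(eqP J01).
rewrite eqEsubset negb_and => /orP[/subsetPn[i2 i2J]|]; last first.
  by rewrite subUset !sub1set i0J i1J.
rewrite !inE negb_or => /andP[i20 i21].
have [h hS hA] := orthogonal_large_support A S (f i2).
pose A' := [set a in A | h a != 0].
(* [g'] contracts the cofactors with h; the slices along i2 contract to 0,
   and [g''] makes their cofactors vanish. *)
pose g' i s x := \sum_(a in A) h a * g i s (update x i2 a).
pose g'' i s x := if i == i2 then 0 else g' i s x.
suff A'le : (#|A'| <= n * #|S|)%N.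
  by rewrite mulSn addnC; apply: leq_trans hA _; rewrite leq_add2r.
apply: (IHn (J :\ i2) _ A' (fun a => d a * h a) g'').
- by move: (cardsD1 i2 J); rewrite cJ i2J add1n => -[].
- by rewrite !inE eq_sym i20.
- by rewrite !inE eq_sym i21.
- by move=> a; rewrite inE => /andP[aA ha]; rewrite mulf_neq0 ?dN0.
split=> [i s x a|x xA'].
  rewrite /g''; case: eqP => // /eqP ii2; apply: eq_bigr => b _.
  by rewrite updateC // gi.
have xA i : i \in J :\ i2 -> x i \in A by move/xA'; rewrite inE => /andP[].
have upA a : a \in A -> forall i, i \in J -> update x i2 a i \in A.
  by move=> aA i iJ; rewrite ffunE; case: eqP => // /eqP ii; apply: xA; rewrite !inE ii.
transitivity (\sum_(a in A) h a * diagonal J i0 d (update x i2 a)).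
  have x_i0A : x i0 \in A by apply: xA; rewrite !inE eq_sym i20.
  have upi0 a : update x i2 a i0 = x i0 by rewrite ffunE eq_sym (negPf i20).
  rewrite (bigD1 (x i0)) //= big1 ?addr0 => [|a /andP[aA ax]]; last first.
    rewrite /diagonal ifF ?mulr0 //; apply/negbTE.
    apply: contra ax => /'forall_implyP/(_ i2 i2J).
    by rewrite upi0 ffunE eqxx.
  rewrite /diagonal upi0.
  have -> : [forall i in J, update x i2 (x i0) i == x i0] = [forall i in J :\ i2, x i == x i0].
    apply/'forall_implyP/'forall_implyP => H i.
      by rewrite !inE => /andP[ii /H]; rewrite ffunE (negPf ii).
    by move=> iJ; rewrite ffunE; have [//|ii] := eqVneq i i2; apply: H; rewrite !inE ii.
  by case: ifP => _; rewrite ?mulr0 // mulrC.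
transitivity (\sum_(a in A) \sum_(i in J) \sum_(s in S)
   h a * (f i s (update x i2 a i) * g i s (update x i2 a))).
  apply: eq_bigr => a aA; rewrite (tE _ (upA a aA)) mulr_sumr.
  by apply: eq_bigr => i _; rewrite mulr_sumr.
rewrite exchange_big /= (big_setD1 i2) //= [X in X + _](_ : _ = 0) ?add0r; last first.
  rewrite exchange_big big1 //= => s sS.
  transitivity ((\sum_(a in A) h a * f i2 s a) * g i2 s x); last by rewrite hS // mul0r.
  rewrite mulr_suml.
  by apply: eq_bigr => a _; rewrite ffunE eqxx gi mulrA.
apply: eq_bigr => i; rewrite !inE => /andP[ii _].
rewrite exchange_big; apply: eq_bigr => s _ /=.
rewrite /g'' (negPf ii) /g' mulr_sumr; apply: eq_bigr => a _.
by rewrite ffunE (negPf ii) mulrCA.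
Qed.
End SliceRank.

(** * Functions of bounded weighted degree over a finite field *)

Section WeightedDegree.
Variables (K : finFieldType) (V : finType) (wt : V -> nat).
Local Notation q := #|K|.
Local Notation exponents := {ffun V -> 'I_q}.
Local Notation points := {ffun V -> K}.

Definition monomial (e : exponents) (y : points) : K := \prod_v y v ^+ e v.
Definition weight (e : exponents) : nat := \sum_v wt v * e v.

(** Exponents are below q, so this is the degree filtration on functions, that
    is, on polynomials modulo the relations x^q = x.  Reduction modulo these
    relations never raises the degree. *)
Definition wdeg_le (w : nat) (phi : points -> K) :=
  exists c : exponents -> K,
    forall y, phi y = \sum_(e | (weight e <= w)%N) c e * monomial e y.

Lemma wdeg_le_ext w phi psi : phi =1 psi -> wdeg_le w phi -> wdeg_le w psi.
Proof. by move=> eq_pp [c cE]; exists c => y; rewrite -eq_pp. Qed.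

Lemma wdeg_le_monomial w e : (weight e <= w)%N -> wdeg_le w (monomial e).
Proof.
move=> ew; exists (fun e' => (e' == e)%:R) => y.
rewrite (bigD1 e) //= eqxx mul1r big1 ?addr0 // => e' /andP[_ /negPf->].
by rewrite mul0r.
Qed.

Lemma wdeg_leZ w a phi : wdeg_le w phi -> wdeg_le w (fun y => a * phi y).
Proof.
move=> [c cE]; exists (fun e => a * c e) => y; rewrite cE mulr_sumr.
by apply: eq_bigr => e _; rewrite mulrA.
Qed.

Lemma wdeg_leD w phi psi :
  wdeg_le w phi -> wdeg_le w psi -> wdeg_le w (fun y => phi y + psi y).
Proof.
move=> [c cE] [c' c'E]; exists (fun e => c e + c' e) => y.
by rewrite cE c'E -big_split; apply: eq_bigr => e _; rewrite mulrDl.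
Qed.

Lemma wdeg_le0 w : wdeg_le w (fun=> 0).
Proof. by exists (fun=> 0) => y; rewrite big1 // => e _; rewrite mul0r. Qed.

Lemma wdeg_leN w phi : wdeg_le w phi -> wdeg_le w (fun y => - phi y).
Proof. by move/(wdeg_leZ (-1)); apply: wdeg_le_ext => y; rewrite mulN1r. Qed.

Lemma wdeg_le_sum w (T : Type) (s : seq T) (P : pred T) (phi : T -> points -> K) :
  (forall i, P i -> wdeg_le w (phi i)) -> wdeg_le w (fun y => \sum_(i <- s | P i) phi i y).
Proof.
move=> phiP; elim: s => [|i s IHs].
  by apply: wdeg_le_ext (wdeg_le0 w) => y; rewrite big_nil.
have [Pi|Pi] := boolP (P i).
  by apply: wdeg_le_ext (wdeg_leD (phiP i Pi) IHs) => y; rewrite big_cons Pi.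
by apply: wdeg_le_ext IHs => y; rewrite big_cons (negPf Pi).
Qed.

Lemma wdeg_leW w w' phi : (w <= w')%N -> wdeg_le w phi -> wdeg_le w' phi.
Proof.
move=> ww' [c cE]; apply: (wdeg_le_ext (fun y => esym (cE y))).
apply: wdeg_le_sum => e ew; apply: wdeg_leZ; apply: wdeg_le_monomial.
exact: leq_trans ew ww'.
Qed.

(** Representative of the exponent m modulo a^q = a; valid for the exponents
    m <= 2 (q-1) that occur in a product of two reduced monomials. *)
Definition fold_exponent (m : nat) : nat := if (m < q)%N then m else (m - q.-1)%N.

Lemma cardK_gt1 : (1 < q)%N. Proof. exact: finNzRing_gt1. Qed.

Lemma fold_exponent_lt m : (m <= q.-1 + q.-1)%N -> (fold_exponent m < q)%N.
Proof.
rewrite /fold_exponent; case: (ltnP m q) => // qm mq.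
by rewrite -[X in (_ < X)%N](prednK (ltnW cardK_gt1)) ltnS leq_subLR.
Qed.

Lemma expr_fold_exponent (a : K) m : a ^+ fold_exponent m = a ^+ m.
Proof.
rewrite /fold_exponent; case: (ltnP m q) => // qm.
rewrite -[in RHS](subnK qm) exprD expf_card -exprSr; congr (_ ^+ _).
by rewrite -[in RHS](prednK (ltnW cardK_gt1)) subnSK // (prednK (ltnW cardK_gt1)).
Qed.

Lemma ord_pred_le (i : 'I_q) : (i <= q.-1)%N.
Proof. by rewrite -ltnS (prednK (ltnW cardK_gt1)). Qed.

Definition add_exponents (e e' : exponents) : exponents :=
  [ffun v => Ordinal (fold_exponent_lt (leq_add (ord_pred_le (e v)) (ord_pred_le (e' v))))].

Lemma monomialM e e' y :
  monomial e y * monomial e' y = monomial (add_exponents e e') y.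
Proof.
by rewrite -big_split; apply: eq_bigr => v _; rewrite ffunE expr_fold_exponent exprD.
Qed.

Lemma weight_add e e' : (weight (add_exponents e e') <= weight e + weight e')%N.
Proof.
rewrite -big_split; apply: leq_sum => v _ /=; rewrite ffunE -mulnDr leq_mul2l.
by apply/orP; right; rewrite /= /fold_exponent; case: ifP => // _; apply: leq_subr.
Qed.

Lemma wdeg_leM w w' phi psi :
  wdeg_le w phi -> wdeg_le w' psi -> wdeg_le (w + w') (fun y => phi y * psi y).
Proof.
move=> [c cE] [c' c'E].
apply: (wdeg_le_ext (phi := fun y => \sum_(e | (weight e <= w)%N)
   \sum_(e' | (weight e' <= w')%N) c e * c' e' * monomial (add_exponents e e') y)).
  move=> y; rewrite cE c'E mulr_suml; apply: eq_bigr => e _.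
  by rewrite mulr_sumr; apply: eq_bigr => e' _; rewrite mulrACA monomialM.
apply: wdeg_le_sum => e ew; apply: wdeg_le_sum => e' ew'; apply: wdeg_leZ.
apply: wdeg_le_monomial; apply: leq_trans (weight_add _ _) (leq_add ew ew').
Qed.

Lemma wdeg_le_cst w a : wdeg_le w (fun=> a).
Proof.
pose e0 : exponents := [ffun=> Ordinal (ltnW cardK_gt1)].
apply: (wdeg_le_ext (phi := fun y => a * monomial e0 y)).
  by move=> y; rewrite /monomial big1 ?mulr1 // => v _; rewrite ffunE expr0.
apply: wdeg_leZ; apply: wdeg_le_monomial.
by rewrite /weight big1 // => v _; rewrite ffunE muln0.
Qed.

Lemma wdeg_le_var v : wdeg_le (wt v) (fun y => y v).
Proof.
pose e1 : exponents := [ffun u => if u == v then Ordinal cardK_gt1 else Ordinal (ltnW cardK_gt1)].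
apply: (wdeg_le_ext (phi := monomial e1)).
  move=> y; rewrite /monomial (bigD1 v) //= ffunE eqxx expr1 big1 ?mulr1 // => u uv.
  by rewrite ffunE (negPf uv).
apply: wdeg_le_monomial; rewrite /weight (bigD1 v) //= ffunE eqxx muln1 big1 ?addn0 // => u uv.
by rewrite ffunE (negPf uv) muln0.
Qed.

Lemma wdeg_leX w phi n : wdeg_le w phi -> wdeg_le (n * w) (fun y => phi y ^+ n).
Proof.
move=> phiP; elim: n => [|n IHn]; first exact: wdeg_le_cst.
by rewrite mulSn; apply: wdeg_le_ext (wdeg_leM phiP IHn) => y; rewrite exprS.
Qed.

Lemma wdeg_le_prod w N (phi : 'I_N -> points -> K) :
  (forall j, wdeg_le w (phi j)) -> wdeg_le (N * w) (fun y => \prod_(j < N) phi j y).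
Proof.
elim: N phi => [|N IHN] phi phiP.
  by apply: wdeg_le_ext (wdeg_le_cst _ 1) => y; rewrite big_ord0.
rewrite mulSn; apply: wdeg_le_ext (wdeg_leM (phiP ord0) (IHN _ (fun j => phiP (lift ord0 j)))).
by move=> y; rewrite big_ord_recl.
Qed.

Definition pdeg_le (w : nat) (Phi : points -> {poly K}) :=
  forall j, wdeg_le w (fun y => (Phi y)`_j).

Lemma pdeg_le_cst w p : pdeg_le w (fun=> p).
Proof. by move=> j; apply: wdeg_le_cst. Qed.

Lemma pdeg_leM w w' Phi Psi :
  pdeg_le w Phi -> pdeg_le w' Psi -> pdeg_le (w + w') (fun y => Phi y * Psi y).
Proof.
move=> PhiP PsiP j.
apply: (wdeg_le_ext (phi := fun y => \sum_(i < j.+1) (Phi y)`_i * (Psi y)`_(j - i))).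
  by move=> y; rewrite coefM.
by apply: wdeg_le_sum => i _; apply: wdeg_leM.
Qed.

Lemma pdeg_leX w Phi n : pdeg_le w Phi -> pdeg_le (n * w) (fun y => Phi y ^+ n).
Proof.
move=> PhiP; elim: n => [|n IHn]; first exact: pdeg_le_cst.
by rewrite mulSn => j; apply: wdeg_le_ext (pdeg_leM PhiP IHn j) => y; rewrite exprS.
Qed.

Lemma pdeg_leW w w' Phi : (w <= w')%N -> pdeg_le w Phi -> pdeg_le w' Phi.
Proof. by move=> ww' PhiP j; apply: wdeg_leW (PhiP j). Qed.

Lemma pdeg_le_sum w (T : Type) (s : seq T) (Phi : T -> points -> {poly K}) :
  (forall i, pdeg_le w (Phi i)) -> pdeg_le w (fun y => \sum_(i <- s) Phi i y).
Proof.
move=> PhiP j; apply: (wdeg_le_ext (phi := fun y => \sum_(i <- s) (Phi i y)`_j)).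
  by move=> y; rewrite coef_sum.
by apply: wdeg_le_sum => i _; apply: PhiP.
Qed.

Lemma pdeg_leB w Phi Psi :
  pdeg_le w Phi -> pdeg_le w Psi -> pdeg_le w (fun y => Phi y - Psi y).
Proof.
move=> PhiP PsiP j; apply: wdeg_le_ext (wdeg_leD (PhiP j) (wdeg_leN (PsiP j))).
by move=> y; rewrite coefB.
Qed.

Lemma pdeg_le_horner w Phi (F : {poly {poly K}}) l : (size F <= l.+1)%N ->
  pdeg_le w Phi -> pdeg_le (l * w) (fun y => F.[Phi y]).
Proof.
move=> sF PhiP j.
apply: (wdeg_le_ext (phi := fun y => (\sum_(i < l.+1) F`_i * Phi y ^+ i)`_j)).
  by move=> y; rewrite (horner_coef_wide _ sF).
apply: (@pdeg_le_sum _ _ _ (fun (i : 'I_l.+1) y => F`_i * Phi y ^+ i)) => i.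
apply: (@pdeg_leW (0 + i * w)); first by rewrite leq_mul2r -ltnS ltn_ord orbT.
by apply: pdeg_leM; [exact: pdeg_le_cst | exact: pdeg_leX].
Qed.

End WeightedDegree.

(** For 0 < e < q-1 some nonzero c has c^e <> 1, as X^e - 1 has at most e roots;
    the substitution a := c a multiplies the sum by c^e.  For e = 0 the sum is
    the cardinal of K, which vanishes by the substitution a := a + 1. *)
Lemma sum_expr_eq0 (K : finFieldType) (e : nat) :
  (e < #|K|.-1)%N -> \sum_(a : K) a ^+ e = 0.
Proof.
case: e => [|e] eq1.
  have : \sum_(a : K) a = \sum_(a : K) (a + 1).
    by rewrite (reindex_inj (addIr 1)).
  by rewrite big_split /= => /eqP; rewrite eq_sym -subr_eq0 addrAC subrr add0r => /eqP.
have [c cN0 cN1] : exists2 c : K, c != 0 & c ^+ e.+1 != 1.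
  apply/exists_inP; apply: contraLR eq1; rewrite negb_exists_in -leqNgt => /forall_inP H.
  rewrite cardE -(size_rem (mem_enum _ 0)).
  apply: max_unity_roots => //.
    by apply/allP => c; rewrite mem_rem_uniq ?enum_uniq // !inE unity_rootE => /andP[/H /negPn->].
  exact/rem_uniq/enum_uniq.
have : \sum_(a : K) a ^+ e.+1 = c ^+ e.+1 * \sum_(a : K) a ^+ e.+1.
  rewrite mulr_sumr (reindex_inj (mulfI cN0)) /=.
  by apply: eq_bigr => a _; rewrite exprMn.
move/eqP; rewrite -{1}[X in X == _]mul1r -subr_eq0 -mulrBl mulf_eq0 => /orP[|/eqP //].
by rewrite subr_eq0 eq_sym (negPf cN1).
Qed.

(** * Summing a polynomial function over part of its variables *)

Section FibreSum.
Variables (K : finFieldType) (k n m wa wb : nat).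
Local Notation q := #|K|.
Local Notation vars := ('I_k * 'I_n + 'I_m)%type.
Local Notation exponents := {ffun vars -> 'I_q}.

(** The variables [inl (i, j)] are the coefficients of the i-th unknown a_i, and
    the variables [inr j] those of b. *)
Definition var_weight (v : vars) : nat := if v is inl _ then wa else wb.

Definition coord_point (x : {ffun 'I_k -> {poly_n K}}) (b : {ffun 'I_m -> K}) :
  {ffun vars -> K} :=
  [ffun v : vars => match v with inl ij => (x ij.1 : {poly K})`_ij.2 | inr j => b j end].

Definition coord_monomial (s : {ffun 'I_n -> 'I_q}) (p : {poly_n K}) : K :=
  \prod_(j < n) (p : {poly K})`_j ^+ s j.

Definition block (e : exponents) (i : 'I_k) : {ffun 'I_n -> 'I_q} :=
  [ffun j : 'I_n => e (inl (i, j))].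

(** Exponents of one block when that block has at most the average degree and
    the [m] variables of b take the weight [wb * m * q.-1]. *)
Definition low_degrees (w : nat) : {set {ffun 'I_n -> 'I_q}} :=
  [set s : {ffun 'I_n -> 'I_q} |
    (k * (wa * \sum_j s j) + wb * m * q.-1 <= w)%N].

Lemma weight_blocks (e : exponents) : weight var_weight e =
  (wa * (\sum_i \sum_j block e i j) + wb * \sum_j e (inr j))%N.
Proof.
rewrite /weight big_sumType /= -!big_distrr /=; congr (_ * _ + _)%N.
by rewrite pair_bigA /=; apply: eq_bigr => -[i j] _; rewrite ffunE.
Qed.

Lemma sum_monomial (e : exponents) x :
  \sum_b monomial e (coord_point x b) =
  (\prod_i coord_monomial (block e i) (x i)) * \prod_j \sum_(a : K) a ^+ e (inr j).
Proof.
rewrite bigA_distr_bigA mulr_sumr; apply: eq_bigr => b _.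
rewrite /monomial big_sumType /=; congr (_ * _); last first.
  by apply: eq_bigr => j _; rewrite ffunE.
by rewrite pair_bigA /=; apply: eq_bigr => -[i j] _; rewrite !ffunE.
Qed.

(** A monomial survives the summation over b only if every variable of b has
    exponent q-1; what remains of the weight is shared by the k blocks. *)
Lemma block_low_degree (e : exponents) w i : (weight var_weight e <= w)%N ->
  (forall i', (\sum_j block e i j <= \sum_j block e i' j)%N) ->
  \prod_j \sum_(a : K) a ^+ e (inr j) != 0 -> block e i \in low_degrees w.
Proof.
move=> ew imin /prodf_neq0 eN0; rewrite inE.
have eq1 j : e (inr j) = q.-1 :> nat.
  apply/eqP; rewrite eqn_leq ord_pred_le leqNgt.
  by apply/negP => /sum_expr_eq0/eqP; rewrite (negPf (eN0 j isT)).
apply: leq_trans ew; rewrite weight_blocks mulnCA -mulnA.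
rewrite (eq_bigr _ (fun j _ => eq1 j)) sum_nat_const card_ord leq_add2r leq_mul2l.
apply/orP; right; rewrite -[X in (X * _ <= _)%N]card_ord -sum_nat_const.
by apply: leq_sum => i' _.
Qed.

(** Every surviving monomial is filed under its block of least degree; grouping
    the monomials by that block and by its exponents gives the slices. *)
Lemma fibre_sum_slices (i0 : 'I_k) w phi (A : {set {poly_n K}}) :
  wdeg_le var_weight w phi ->
  exists g, slice_expansion [set: 'I_k] A (low_degrees w)
    (fun x => \sum_b phi (coord_point x b)) (fun=> coord_monomial) g.
Proof.
move=> [c cE].
pose bsum (e : exponents) := \prod_j \sum_(a : K) a ^+ e (inr j).
pose imin (e : exponents) := [arg min_(i < i0) (\sum_j block e i j)]%N.
have iminP e i' : (\sum_j block e (imin e) j <= \sum_j block e i' j)%N.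
  by rewrite /imin; case: arg_minnP => // i _; apply.
pose P e := (weight var_weight e <= w)%N && (block e (imin e) \in low_degrees w).
pose g i s x := \sum_(e | (P e && (imin e == i)) && (block e i == s))
  c e * bsum e * \prod_(i' | i' != i) coord_monomial (block e i') (x i').
exists g; split=> [i s x a|x _].
  apply: eq_bigr => e _; congr (_ * _); apply: eq_bigr => i' ii'.
  by rewrite ffunE (negPf ii').
pose H e := c e * bsum e * \prod_i coord_monomial (block e i) (x i).
transitivity (\sum_(e | P e) H e).
  rewrite (eq_bigr _ (fun b _ => cE (coord_point x b))) exchange_big /=.
  rewrite big_mkcond [RHS]big_mkcond; apply: eq_bigr => e _ /=.
  rewrite /P; case: (boolP (weight _ _ <= w)%N) => //= ew.
  rewrite -mulr_sumr sum_monomial -/(bsum e) [X in c e * X]mulrC mulrA -/(H e).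
  case: ifPn => // bN; rewrite /H; have [->|bsN0] := eqVneq (bsum e) 0.
    by rewrite mulr0 mul0r.
  by case/negP: bN; apply: block_low_degree.
rewrite (partition_big imin (mem [set: 'I_k])) => [|e _]; last exact: in_setT.
apply: eq_bigr => i _.
rewrite (partition_big (block^~ i) (mem (low_degrees w))) => [|e /andP[/andP[_ bS] /eqP<-]] //.
apply: eq_bigr => s _; rewrite mulr_sumr; apply: eq_bigr => e /andP[_ /eqP<-].
by rewrite /H (bigD1 i) //= mulrCA.
Qed.

End FibreSum.

(** * The tensor counting solutions *)

Definition poly_of_coefs (K : finFieldType) (N : nat) (b : 'I_N -> K) : {poly K} :=
  \sum_(j < N) b j *: 'X^j.

Lemma coef_poly_of_coefs (K : finFieldType) N (b : 'I_N -> K) (j : 'I_N) :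
  (poly_of_coefs b)`_j = b j.
Proof.
rewrite coef_sum (bigD1 j) //= coefZ coefXn eqxx mulr1 big1 ?addr0 // => i ij.
by rewrite coefZ coefXn eq_sym (inj_eq val_inj) (negPf ij) mulr0.
Qed.

Lemma size_poly_of_coefs (K : finFieldType) N (b : 'I_N -> K) :
  (size (poly_of_coefs b) <= N)%N.
Proof.
apply: leq_trans (size_sum _ _ _) _; apply/bigmax_leqP => j _.
by apply: leq_trans (size_scale_leq _ _) _; rewrite size_polyXn.
Qed.

Section SolutionTensor.
Variables (K : finFieldType) (r k l n m : nat).
Variables (cs : 'I_k -> {poly K}) (F : {poly {poly K}}).
Local Notation q := #|K|.
Local Notation vars := ('I_k * 'I_n + 'I_m)%type.

Definition equation (y : {ffun vars -> K}) : {poly K} :=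
  \sum_i cs i * poly_of_coefs (fun j : 'I_n => y (inl (i, j))) ^+ r
    - F.[poly_of_coefs (fun j => y (inr j))].

Lemma equation_coord_point x b : equation (coord_point x b) =
  \sum_i cs i * (x i : {poly K}) ^+ r - F.[poly_of_coefs b].
Proof.
rewrite /equation; congr (_ - F.[_]); last by apply: eq_bigr => j _; rewrite ffunE.
apply: eq_bigr => i _; congr (_ * _ ^+ _).
transitivity (\sum_(j < n) (x i : {poly K})`_j *: 'X^j).
  by apply: eq_bigr => j _; rewrite ffunE.
rewrite -poly_def; apply/polyP => j; rewrite coef_poly; case: ltnP => // nj.
by rewrite nth_default // (leq_trans (size_npoly _)).
Qed.

Lemma pdeg_le_coords N (v : 'I_N -> vars) w : (forall j, var_weight l r (v j) = w) ->
  pdeg_le (var_weight l r) w (fun y : {ffun vars -> K} => poly_of_coefs (fun j => y (v j))).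
Proof.
move=> vw; apply: pdeg_le_sum => j i.
apply: (wdeg_le_ext (phi := fun y => ('X^j)`_i * y (v j))).
  by move=> y; rewrite coefZ mulrC.
by apply: wdeg_leZ; rewrite -(vw j); apply: wdeg_le_var.
Qed.

(** The weights are chosen so that the r-th powers, of degree r in variables of
    weight l, and F(b), of degree l in variables of weight r, balance. *)
Lemma pdeg_le_equation : (size F <= l.+1)%N ->
  pdeg_le (var_weight l r) (r * l) equation.
Proof.
move=> sF; apply: pdeg_leB; last first.
  by rewrite mulnC; apply: pdeg_le_horner => //; apply: pdeg_le_coords.
apply: pdeg_le_sum => i; rewrite -[(r * l)%N]add0n; apply: pdeg_leM; first exact: pdeg_le_cst.
by apply: pdeg_leX; apply: pdeg_le_coords.
Qed.

Definition solution_test N (y : {ffun vars -> K}) : K :=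
  \prod_(j < N) (1 - (equation y)`_j ^+ q.-1).

Lemma wdeg_le_solution_test N : (size F <= l.+1)%N ->
  wdeg_le (var_weight l r) (N * (q.-1 * (r * l))) (solution_test N).
Proof.
move=> sF; apply: wdeg_le_prod => j.
apply: (wdeg_leD (wdeg_le_cst _ _ 1) (wdeg_leN _)).
by apply: wdeg_leX; apply: pdeg_le_equation.
Qed.

(** If the equation fails, its leading coefficient alpha is nonzero, so
    alpha^(q-1) = 1 and one factor of the product vanishes. *)
Lemma solution_testE N y : (size (equation y) <= N)%N ->
  solution_test N y = (equation y == 0)%:R.
Proof.
have q1 : (0 < q.-1)%N by rewrite -ltnS (prednK (ltnW (cardK_gt1 K))) cardK_gt1.
move=> sN; case: (eqVneq (equation y) 0) => [e0|eN0].
  by rewrite /solution_test big1 // => j _; rewrite e0 coef0 expr0n gtn_eqF // subr0.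
have ltN : ((size (equation y)).-1 < N)%N.
  by apply: leq_trans sN; rewrite prednK // size_poly_gt0.
apply/eqP/prodf_eq0; exists (Ordinal ltN) => //=.
have lN0 : lead_coef (equation y) != 0 by rewrite lead_coef_eq0.
rewrite subr_eq0 eq_sym; apply/eqP/(mulfI lN0).
by rewrite -exprS (prednK (ltnW (cardK_gt1 K))) expf_card mulr1.
Qed.

(** A solution (a, ..., a; b) with b <> 0 is nontrivial, so the hypothesis also
    says that F has no nonzero root of degree less than m: the diagonal entries
    of the counting tensor are exactly 1. *)
Lemma card_no_nontrivial_solution (A : {set {poly_n K}}) N :
  (1 < k)%N -> (size F <= l.+1)%N -> F`_0 = 0 -> \sum_i cs i = 0 ->
  (forall y, (size (equation y) <= N)%N) ->
  (forall a b, is_solution r cs F A a b -> is_trivial A a b) ->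
  (#|A| <= k * #|low_degrees K k n m l r (N * (q.-1 * (r * l)))|)%N.
Proof.
move=> k_gt1 sF F0 cs0 sN Atriv.
pose i0 : 'I_k := Ordinal (ltnW k_gt1); pose i1 : 'I_k := Ordinal k_gt1.
have [g [gi gE]] := fibre_sum_slices i0 A (wdeg_le_solution_test N sF).
set S := low_degrees _ _ _ _ _ _ _ in gE *.
suff : (#|A| <= #|[set: 'I_k]| * #|S|)%N by rewrite cardsT card_ord.
apply: (@diagonal_slice_rank K _ _ _ i0 i1 _ _ _ (fun=> 1)
  (fun=> @coord_monomial K n) g); rewrite ?in_setT //.
  by move=> a _; apply: oner_neq0.
split=> // x xA; apply: etrans (gE x xA); apply/esym => /=.
rewrite (eq_bigr _ (fun b _ => solution_testE (sN _))).
under eq_bigr do rewrite equation_coord_point subr_eq0.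
have {}Atriv (b : {ffun 'I_m -> K}) : \sum_i cs i * (x i : {poly K}) ^+ r == F.[poly_of_coefs b] ->
    is_trivial A x (poly_of_coefs b).
  by move/eqP => sol; apply: Atriv; split=> // i; apply: xA; rewrite inE.
rewrite /diagonal; case: ifPn => [/'forall_implyP xE|].
  rewrite (bigD1 [ffun=> 0]) //=.
  have -> : poly_of_coefs ([ffun=> 0] : {ffun 'I_m -> K}) = 0.
    by rewrite /poly_of_coefs big1 // => j _; rewrite ffunE scale0r.
  have xsum : \sum_i cs i * (x i : {poly K}) ^+ r = 0.
    transitivity ((\sum_i cs i) * (x i0 : {poly K}) ^+ r); last by rewrite cs0 mul0r.
    by rewrite mulr_suml; apply: eq_bigr => i _; rewrite (eqP (xE i _)) ?inE.
  rewrite xsum horner_coef0 F0 eqxx big1 ?addr0 // => b bN0.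
  case: eqP => // /eqP Fb; case/negP: bN0.
  have [|_ b0] := Atriv b; first by rewrite xsum.
  by apply/eqP/ffunP => j; rewrite -coef_poly_of_coefs b0 coef0 ffunE.
move=> xN; apply: big1 => b _; case: eqP => // /eqP /Atriv[[a _ xa] _].
by case/negP: xN; apply/'forall_implyP => i _; rewrite !xa.
Qed.

End SolutionTensor.

(** With deg b < r n / l, the powers of b in F(b) have degree at most r n, the
    same as the r-th powers. *)
Lemma size_equation_le (K : finFieldType) (r k l n d : nat) (F : {poly {poly K}})
  (cs : 'I_k -> {poly K}) y : (size F <= l.+1)%N ->
  (forall i, (size (cs i) <= d.+1)%N) ->
  (size (@equation K r k n (r * n %/ l) cs F y) <=
    r * n + (d + (\max_(i < l.+1) size (F`_i)%R) + 1))%N.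
Proof.
move=> sF scs; set D := \max_(i < _) _.
have size_mul_exp (p b : {poly K}) e s t :
    (size p <= s)%N -> (size b <= t)%N -> (size (p * b ^+ e)%R <= s + t * e)%N.
  move=> sp sb; apply: leq_trans (size_polyMleq _ _) _.
  have := size_poly_exp_leq b e; have : ((size b).-1 * e <= t * e)%N.
    by rewrite leq_mul2r (leq_trans (leq_pred _) sb) orbT.
  by lia.
apply: leq_trans (size_polyD _ _) _; rewrite geq_max size_polyN; apply/andP; split.
  apply: leq_trans (size_sum _ _ _) _; apply/bigmax_leqP => i _.
  apply: leq_trans (size_mul_exp _ _ _ _ _ (scs i) (size_poly_of_coefs _)) _.
  by rewrite (mulnC n); lia.
rewrite (horner_coef_wide _ sF).
apply: leq_trans (size_sum _ _ _) _; apply/bigmax_leqP => i _.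
have sFi : (size (F`_i)%R <= D)%N by apply: (leq_bigmax i).
apply: leq_trans (size_mul_exp _ _ _ _ _ sFi (size_poly_of_coefs _)) _.
have : (r * n %/ l * i <= r * n)%N.
  by apply: leq_trans (leq_trunc_div (r * n) l); rewrite leq_mul2l -ltnS ltn_ord orbT.
by lia.
Qed.

(** * Exponential bound for the number of monomials of low degree *)

Lemma bernoulli_lower (R : realFieldType) (eps : R) m :
  0 <= eps <= 1 -> 1 - m%:R * eps <= (1 - eps) ^+ m.
Proof.
move=> /andP[e0 e1]; elim: m => [|m IHm]; first by rewrite expr0; lra.
have m0 : 0 <= m%:R :> R by rewrite ler0n.
have : 0 <= m%:R * eps ^+ 2 by rewrite mulr_ge0 // sqr_ge0.
have : (1 - eps) * (1 - m%:R * eps) <= (1 - eps) * (1 - eps) ^+ m by rewrite ler_wpM2l // subr_ge0.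
rewrite [(1 - eps) ^+ m.+1]exprS -natr1; lra.
Qed.

Lemma bernoulli_upper (R : realFieldType) (eps : R) m :
  0 <= eps <= 1 -> (1 - eps) ^+ m <= 1 - m%:R * eps + m%:R ^+ 2 * eps ^+ 2.
Proof.
move=> /andP[e0 e1]; elim: m => [|m IHm]; first by rewrite expr0 mul0r expr0n mul0r subr0 addr0.
have m0 : 0 <= m%:R :> R by rewrite ler0n.
have : 0 <= (m%:R + 1) * eps ^+ 2 by rewrite mulr_ge0 ?sqr_ge0 //; lra.
have : 0 <= m%:R ^+ 2 * eps ^+ 3 by rewrite mulr_ge0 ?sqr_ge0 ?exprn_ge0.
have : (1 - eps) * (1 - eps) ^+ m <= (1 - eps) * (1 - m%:R * eps + m%:R ^+ 2 * eps ^+ 2).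
  by rewrite ler_wpM2l // subr_ge0.
rewrite [(1 - eps) ^+ m.+1]exprS -natr1; lra.
Qed.

Lemma sum_ord_double q : ((\sum_(e < q) e) * 2 = q * q.-1)%N.
Proof.
elim: q => [|q IHq]; first by rewrite big_ord0.
by rewrite big_ord_recr /= mulnDl IHq; case: q {IHq} => //= q; lia.
Qed.

(** At z = 1 both sides equal q, and the derivative u q (q-1) / 2 of the left one
    exceeds that of the right one, v q (q-1); hence the inequality holds slightly below 1.  The
    second-order Bernoulli bounds make this quantitative. *)
Lemma saddle_point (R : realFieldType) (q u v : nat) : (1 < q)%N -> (2 * v < u)%N ->
  exists2 z : R, 0 < z < 1 & \sum_(e < q) z ^+ (u * e) < q%:R * z ^+ (v * q.-1).
Proof.
move=> q_gt1 vu.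
have q2 : 2%:R <= q%:R :> R by rewrite ler_nat.
have u1 : 1 <= u%:R :> R by rewrite -[1]/(1%:R) ler_nat; lia.
have vuR : 2 * v%:R + 1 <= u%:R :> R by rewrite -[2]/(2%:R) -natrM -[1]/(1%:R) -natrD ler_nat; lia.
have v0 : 0 <= v%:R :> R by rewrite ler0n.
(* With z = 1 - eps and after division by q, the gain (q-1)(u/2 - v) eps is at
   least eps / 2, against a second-order loss of at most u^2 q^2 eps^2. *)
pose B : R := 4 * u%:R ^+ 2 * q%:R ^+ 2.
have B1 : 1 < B.
  rewrite /B -mulrA -exprMn; have : 2 <= u%:R * q%:R :> R by nra.
  by nra.
pose eps := B^-1.
have e0 : 0 < eps by rewrite invr_gt0; lra.
have e1 : eps < 1 by rewrite invf_lt1 //; lra.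
have eB : eps * B = 1 by rewrite mulVf //; lra.
have e01 : 0 <= eps <= 1 by apply/andP; split; lra.
exists (1 - eps); first by apply/andP; split; lra.
have q1E : q.-1%:R = q%:R - 1 :> R by rewrite -subn1 natrB // ltnW.
have := bernoulli_lower (v * q.-1) e01; rewrite natrM q1E => lowB.
have upB : \sum_(e < q) (1 - eps) ^+ (u * e) <=
   q%:R - (u%:R * eps) * (\sum_(e < q) e%:R) + q%:R * (u%:R ^+ 2 * q%:R ^+ 2 * eps ^+ 2).
  have -> : q%:R = \sum_(e < q) (1 : R) by rewrite sumr_const card_ord.
  rewrite !mulr_sumr -sumrB mulr_suml -big_split /=; apply: ler_sum => e _.
  apply: le_trans (bernoulli_upper _ e01) _; rewrite natrM mul1r sumr_const card_ord.
  rewrite mulrAC lerD2l ler_wpM2r ?sqr_ge0 // exprMn ler_wpM2l ?sqr_ge0 //.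
  by rewrite lerXn2r ?nnegrE ?ler0n // ler_nat ltnW.
have sE : (\sum_(e < q) e%:R) * 2 = q%:R * (q%:R - 1) :> R.
  by rewrite -q1E -natrM -sum_ord_double natrM natr_sum.
apply: le_lt_trans upB _.
apply: (lt_le_trans _ (ler_wpM2l (ler0n R q) lowB)).
set s := \sum_(e < q) _ in sE *.
have -> : s = q%:R * (q%:R - 1) / 2 by rewrite -sE; field.
rewrite -subr_gt0.
have -> : q%:R * (1 - v%:R * (q%:R - 1) * eps) - (q%:R - u%:R * eps * (q%:R * (q%:R - 1) / 2)
   + q%:R * (u%:R ^+ 2 * q%:R ^+ 2 * eps ^+ 2)) =
   q%:R * eps * ((q%:R - 1) * (u%:R / 2 - v%:R) - u%:R ^+ 2 * q%:R ^+ 2 * eps) by field.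
apply: mulr_gt0; first by apply: mulr_gt0 => //; lra.
have -> : u%:R ^+ 2 * q%:R ^+ 2 * eps = 1 / 4 :> R by move: eB; rewrite /B; lra.
nra.
Qed.

(** Markov's inequality in the form of Chernoff: each counted s contributes at
    least z^(v (q-1) n + C) to the sum of z^(u |s|) over all s, which factors. *)
Lemma low_degree_count (R : realFieldType) (q u v n C : nat) (z : R) : 0 < z < 1 ->
  #|[set s : {ffun 'I_n -> 'I_q} | (u * \sum_j s j <= v * q.-1 * n + C)%N]|%:R
    <= (z ^+ C)^-1 * ((\sum_(e < q) z ^+ (u * e)) / z ^+ (v * q.-1)) ^+ n.
Proof.
move=> /andP[z0 z1]; set S := [set s | _].
have main : #|S|%:R * z ^+ (v * q.-1 * n + C) <= (\sum_(e < q) z ^+ (u * e)) ^+ n.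
  have -> : (\sum_(e < q) z ^+ (u * e)) ^+ n = \prod_(j < n) \sum_(e < q) z ^+ (u * e).
    by rewrite prodr_const card_ord.
  rewrite bigA_distr_bigA /= mulr_natl -sumr_const.
  apply: le_trans (_ : \sum_(s in S) \prod_(j < n) z ^+ (u * s j) <= _).
    apply: ler_sum => s; rewrite inE => sS.
    by rewrite prodrXr -big_distrr /= ler_wiXn2l ?ltW.
  rewrite [leRHS](bigID (mem S)) /= lerDl; apply: sumr_ge0 => s _.
  by apply: prodr_ge0 => j _; rewrite exprn_ge0 // ltW.
by rewrite expr_div_n -exprM mulrCA -invfM -exprD addnC ler_pdivlMr ?exprn_gt0.
Qed.

(** * The density bound *)

Theorem theorem5 (R : realType) (q r k l : nat)
    (k_gt1 : (1 < k)%N) (l_gt0 : (0 < l)%N)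
    (hk : 2 * r%:R ^+ 2 * (1 - 1 / l%:R ^+ 2) < k%:R :> R) :
  exists2 c : R, 0 < c < 1 &
  forall Fq : finFieldType, #|Fq| = q ->
  forall (d : nat) (F : {poly {poly Fq}}), size F = l.+1 -> F`_0 = 0 ->
  exists2 c' : R, 0 < c' &
  forall cs : 'I_k -> {poly Fq},
    (forall i, (size (cs i) <= d.+1)%N) -> \sum_(i < k) cs i = 0 ->
  forall (n : nat) (A : {set {poly_n Fq}}),
    c' * q%:R `^ (c * n%:R) < #|A|%:R ->
  exists (a : 'I_k -> {poly_n Fq}) (b : {poly Fq}),
    is_solution r cs F A a b /\ ~ is_trivial A a b.
Proof.
(* No finite field has fewer than two elements. *)
have [q_gt1|q_le1] := ltnP 1 q; last first.
  exists (1 / 2); first by apply/andP; split; lra.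
  by move=> Fq cFq; have := cardK_gt1 Fq; rewrite cFq ltnNge q_le1.
(* Clearing the denominator l^2: v / u is the average degree per block, in
   units of (q-1) n. *)
pose u := (k * l ^ 2)%N; pose v := (r ^ 2 * (l ^ 2).-1)%N.
have vu : (2 * v < u)%N.
  have l0 : 0 < l%:R ^+ 2 :> R by rewrite exprn_gt0 // ltr0n.
  have l2E : (l ^ 2).-1%:R = l%:R ^+ 2 - 1 :> R.
    by rewrite -subn1 natrB ?expn_gt0 ?l_gt0 // natrX.
  rewrite -(ltr_nat R) /u /v !(natrX, natrM) l2E.
  move: (hk); rewrite -(ltr_pM2r l0 (2 * _ * _)); congr (_ < _).
  by field; rewrite pnatr_eq0 -lt0n.
have [z z01 gap] := saddle_point R q_gt1 vu.
have [z0 z1] := andP z01.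
have q0 : 0 < q%:R :> R by rewrite ltr0n ltnW.
pose gam : R := (\sum_(e < q) z ^+ (u * e)) / z ^+ (v * q.-1).
have gam_ltq : gam < q%:R by rewrite ltr_pdivrMr ?exprn_gt0.
have gam_gt1 : 1 < gam.
  rewrite ltr_pdivlMr ?exprn_gt0 // mul1r.
  apply: le_lt_trans (exprn_ile1 _ (ltW z0) (ltW z1)) _.
  rewrite -(prednK (ltnW q_gt1)) big_ord_recl muln0 expr0 ltrDl.
  case: q q_gt1 {gap gam gam_ltq q0} => [|[|q]] // _.
  rewrite big_ord_recl; apply: ltr_wpDr; last exact: exprn_gt0.
  by apply: sumr_ge0 => e _; rewrite exprn_ge0 // ltW.
have gam0 : 0 < gam by apply: lt_trans gam_gt1.
have lnq0 : 0 < ln q%:R :> R by apply: ln_gt0; rewrite ltr1n.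
(* This exponent satisfies q^c = gam. *)
exists (ln gam / ln q%:R).
  apply/andP; split; first by rewrite divr_gt0 // ln_gt0.
  by rewrite ltr_pdivrMr // mul1r ltr_ln ?posrE.
move=> Fq cFq d F sF F0.
pose C := (q.-1 * (r * l * l * (d + (\max_(i < l.+1) size (F`_i)%R) + 1) + r * l))%N.
exists (k%:R / z ^+ C); first by rewrite divr_gt0 ?exprn_gt0 // ltr0n ltnW.
move=> cs scs cs0 n A; apply: contraPP => no_sol; apply/negP; rewrite -leNgt.
have powE : q%:R `^ (ln gam / ln q%:R * n%:R) = gam ^+ n.
  rewrite powRrM powR_mulrn ?powR_ge0 //; congr (_ ^+ _).
  by rewrite /powR gt_eqF // divfK ?gt_eqF // lnK.
rewrite powE -mulrA.
pose m := (r * n %/ l)%N.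
pose N := (r * n + (d + (\max_(i < l.+1) size (F`_i)%R) + 1))%N.
have sFle : (size F <= l.+1)%N by rewrite sF.
have Atriv a b : is_solution r cs F A a b -> is_trivial A a b.
  by move=> sol; apply: contrapT => ntriv; apply: no_sol; exists a, b.
have := card_no_nontrivial_solution k_gt1 sFle F0 cs0
  (fun y => @size_equation_le Fq r k l n d F cs y sFle scs) Atriv.
rewrite -(ler_nat R) natrM => /le_trans; apply; rewrite ler_wpM2l ?ler0n //.
apply: le_trans _ (low_degree_count q u v n C z01); rewrite ler_nat -cFq.
apply: subset_leq_card; apply/subsetP => s; rewrite !inE -/m -/N.
move=> deg_s; rewrite -(leq_pmul2r l_gt0) in deg_s.
(* m exceeds r n / l - 1, and the rounding error goes into C. *)
have mP : (r * n <= m * l + l)%N.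
  by rewrite {1}(divn_eq (r * n) l) leq_add2l ltnW // ltn_mod.
have {}mP : (r * q.-1 * (r * n) <= r * q.-1 * (m * l + l))%N by rewrite leq_mul2l mP orbT.
rewrite /u /v /C -cFq; rewrite -cFq in mP; rewrite /N in deg_s.
set Q := #|Fq|.-1 in deg_s mP *.
have l2E : ((l ^ 2).-1 + 1 = l * l)%N by rewrite addn1 prednK ?expn_gt0 ?l_gt0 // mulnn.
have split_main : (r ^ 2 * (l ^ 2).-1 * Q * n + r * Q * (r * n) =
    r * n * Q * r * (l * l))%N by rewrite -l2E -mulnn; ring.
move: deg_s mP split_main; rewrite -[(l ^ 2)%N]mulnn.
move: (\sum_j _)%N (d + _ + 1)%N (r ^ 2 * _ * _ * n)%N => S E X; nia.
Qed.
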